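(* Let $(X,\mu)$ be a standard probability space with an ergodic measure-preserving $\mathbb{Z}$-action generated by $T$, let $B$ be a separable reflexive Banach space, let $c:\mathbb{Z}\times X\to\mathrm{Isom}(B)$ be a Borel cocycle ($c(n+m,x)=c(n,x)c(m,T^nx)$, $(n,x)\mapsto c(n,x).b$ measurable), and let $s:X\times\mathbb{Z}\times\mathbb{Z}\to B$ satisfy $s_x(m,l)+s_x(l,n)=s_x(m,n)$, $c(k,x).s_{T^kx}(m,n)=s_x(m+k,n+k)$, with $x\mapsto s_x(m,n)$ weakly measurable and $x\mapsto\|s_x(0,n)\|_B$ integrable for all $n$. Let $\rho_x(m,n)=\|s_x(m,n)\|_B$ and $A=\lim_{n\to\infty}\frac1n\int_X\rho_x(0,n)\,d\mu(x)$. Then there exist an integrable function $\varphi$ on $X$ with $\int_X\varphi\,d\mu=A$ and nonnegative measurable functions $r_n$ ($n\ge1$) such that \[ \rho_x(0,n)=\sum_{k=0}^{n-1}\varphi(T^kx)+r_n(x) \] for a.e. $x$ and all $n\ge1$, where $(r_n)$ is subadditive ($r_{n+m}(x)\le r_n(x)+r_m(T^nx)$) with $\lim_{n\to\infty}\frac1n\int_X r_n\,d\mu=0$.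
   Context: Weakly measurable: $x\mapsto\langle\phi,s_x(m,n)\rangle$ measurable for all $\phi\in B^*$. *)

(* Defs.v *)
From HB Require Import structures.
From mathcomp Require Import all_boot all_order all_algebra.
From mathcomp Require Import all_classical all_reals all_analysis.
Set Implicit Arguments. Unset Strict Implicit. Unset Printing Implicit Defensive.
Import Order.TTheory GRing.Theory Num.Theory.
Import numFieldNormedType.Exports.
Local Open Scope classical_set_scope.
Local Open Scope ring_scope.

(* Standard Borel space: Borel-isomorphic to a Borel subset of R
   (Kuratowski: every standard Borel space is such, and conversely). *)
Definition standard_borel {d} {R : realType} (X : measurableType d) : Prop :=
  exists f : X -> R,
    [/\ injective f, measurable (range f),
        measurable_fun setT f &
        forall A : set X, measurable A -> measurable (f @` A)].

Definition zact {X : Type} (T Tinv : X -> X) (n : int) : X -> X :=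
  match n with
  | Posz k => iter k T
  | Negz k => iter k.+1 Tinv
  end.

Definition inv_mpt {d} {R : realType} {X : measurableType d}
  (mu : probability X R) (T Tinv : X -> X) : Prop :=
  [/\ cancel T Tinv, cancel Tinv T,
      measurable_fun setT T, measurable_fun setT Tinv &
      forall A : set X, measurable A -> mu (T @^-1` A) = mu A].

Definition ergodic {d} {R : realType} {X : measurableType d}
  (mu : probability X R) (T : X -> X) : Prop :=
  forall A : set X, measurable A -> T @^-1` A = A ->
    mu A = 0%E \/ mu A = 1%E.

Definition cont_lin_functional {R : realType} {B : normedModType R}
  (phi : B -> R) : Prop :=
  (forall (a : R) (u v : B), phi (a *: u + v) = a * phi u + phi v) /\
  continuous phi.

Definition reflexive_space {R : realType} (B : normedModType R) : Prop :=
  forall Psi : (B -> R) -> R,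
    (forall (a : R) (phi1 phi2 : B -> R),
        cont_lin_functional phi1 -> cont_lin_functional phi2 ->
        Psi (fun b => a * phi1 b + phi2 b) = a * Psi phi1 + Psi phi2) ->
    (exists C : R, forall (phi : B -> R) (K : R),
        cont_lin_functional phi -> (forall b, `|phi b| <= K * `|b|) ->
        `|Psi phi| <= C * K) ->
    exists b : B, forall phi, cont_lin_functional phi -> Psi phi = phi b.

Definition separable_space {R : realType} (B : normedModType R) : Prop :=
  exists u : nat -> B, closure (range u) = setT.

Definition lin_isometry {R : realType} {B : normedModType R} (g : B -> B) : Prop :=
  [/\ forall (a : R) (u v : B), g (a *: u + v) = a *: g u + g v,
      forall u, `|g u| = `|u| & forall v, exists u, g u = v].

Definition borel_measurable {d} {R : realType} {X : measurableType d}
  {B : normedModType R} (f : X -> B) : Prop :=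
  forall U : set B, open U -> measurable (f @^-1` U).

Definition weakly_measurable {d} {R : realType} {X : measurableType d}
  {B : normedModType R} (f : X -> B) : Prop :=
  forall phi : B -> R, cont_lin_functional phi ->
    measurable_fun setT (fun x => phi (f x)).

(* Main.v *)
Require Import Defs.
From HB Require Import structures.
From mathcomp Require Import all_boot all_order all_algebra.
From mathcomp Require Import all_classical all_reals all_analysis.
From mathcomp Require Import measurable_realfun ring lra.
Import Order.TTheory GRing.Theory Num.Theory.
Import numFieldNormedType.Exports.
Local Open Scope classical_set_scope.
Local Open Scope ring_scope.

(* The norms [g n x = `|s x 0 n|] form a nonnegative integrable subadditive
   cocycle, so the claim is a Kingman decomposition.  The averages
   [f_n = n^-1 * \sum_(k < n) (g k.+1 - g k \o T)] satisfy [f_n <= g 1],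
   [\int f_n = n^-1 * \int (g n)], and, by telescoping and subadditivity, their
   Birkhoff sums of length [m <= n] are at most [g m + E m / n] with [E m]
   independent of [n].  These conditions on a function [f] cut out decreasing
   convex sets; writing [f = g 1 - h] with [0 <= h], almost minimizers of
   [\int exp (- h)] over these sets converge almost everywhere, and by Fatou's
   lemma their limit is an [f] whose integral is [A] and whose Birkhoff sums
   minorize [g].  The remainder is the positive part of the difference. *)

(** * Finite double sums and the limit of a subadditive sequence *)

Lemma sum_increments (R : realFieldType) (a : nat -> nat -> R) (m n : nat) :
  (forall j, a 0%N j = 0) ->
  \sum_(j < m) \sum_(k < n) (a k.+1 j - a k j.+1) =
  \sum_(j < m) a n j + \sum_(k < n) (a k 0%N - a k m).
Proof.
move=> a0; elim: n => [|n IH].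
  by rewrite big_ord0 addr0; apply: eq_bigr => j _; rewrite a0 big_ord0.
under eq_bigr do rewrite big_ord_recr /=.
rewrite big_split /= IH big_ord_recr /= !sumrB.
(* Splitting off either end of the same sum over [m.+1] indices turns the shift [j.+1] into boundary
   terms. *)
have h : \sum_(j < m) a n j + a n m = a n 0%N + \sum_(j < m) a n j.+1.
  by rewrite -(big_ord_recr m (fun j => a n j)) /= big_ord_recl.
have -> : \sum_(j < m) a n j.+1 = \sum_(j < m) a n j + a n m - a n 0%N.
  by rewrite h addrC addKr.
ring.
Qed.

(** Here [a k j] stands for [g k] at the [j]-th iterate. With [n = p + m], each [a n j] is split at
    time [m] into [a (m - j) j] and [a (p + j) m], and each [a (m + k) 0] into [a m 0] and [a k m].
    The terms at time [m] cancel against the negative sum, leaving at most [n] copies of [a m 0] and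
    an error free of [n]. *)
Lemma sum_increments_le (R : realFieldType) (a : nat -> nat -> R) (m n : nat) :
  (forall j, a 0%N j = 0) -> (forall k j, 0 <= a k j) ->
  (forall k l j, a (k + l)%N j <= a k j + a l (j + k)%N) -> (m <= n)%N ->
  \sum_(j < m) \sum_(k < n) (a k.+1 j - a k j.+1) <=
  n%:R * a m 0%N + (\sum_(j < m) a (m - j)%N j + \sum_(k < m) a k 0%N).
Proof.
move=> a0 age0 asub mn; rewrite sum_increments // sumrB.
have [p ->] : exists p, n = (p + m)%N by exists (n - m)%N; rewrite subnK.
have split_sum (q r l : nat) : \sum_(k < q + r) a k l =
    \sum_(k < q) a k l + \sum_(k < r) a (q + k)%N l by rewrite big_split_ord.
rewrite [X in _ + (_ - X)]split_sum.
have -> : \sum_(k < p + m) a k 0%N =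
    \sum_(k < m) a k 0%N + \sum_(k < p) a (m + k)%N 0%N by rewrite addnC split_sum.
have h1 : \sum_(j < m) a (p + m)%N j <=
    \sum_(j < m) a (m - j)%N j + \sum_(j < m) a (p + j)%N m.
  rewrite -big_split /=; apply: ler_sum => j _.
  have jm : (j <= m)%N by exact: ltnW.
  have -> : (p + m = (m - j) + (p + j))%N by rewrite addnCA subnK.
  by apply: le_trans (asub _ _ _) _; rewrite subnKC.
have h2 : \sum_(k < p) a (m + k)%N 0%N <= p%:R * a m 0%N + \sum_(k < p) a k m.
  have -> : p%:R * a m 0%N = \sum_(k < p) a m 0%N.
    by rewrite sumr_const card_ord mulr_natl.
  by rewrite -big_split /=; apply: ler_sum => k _; exact: asub.
have h3 : p%:R * a m 0%N <= (p + m)%:R * a m 0%N.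
  by apply: ler_wpM2r => //; rewrite ler_nat leq_addr.
lra.
Qed.

Lemma fekete {R : realType} {a : nat -> R} :
  a 0%N = 0 -> (forall n, 0 <= a n) ->
  (forall n m, a (n + m)%N <= a n + a m) ->
  (fun n => n%:R^-1 * a n) @ \oo -->
    inf [set n%:R^-1 * a n | n in [set n | (0 < n)%N]].
Proof.
move=> a0 age0 asub; set S := [set _ | _ in _]; set L := inf S.
have Sinf : has_inf S.
  split; first by exists (1%:R^-1 * a 1%N), 1%N.
  by exists 0 => _ [n _ <-]; rewrite mulr_ge0 ?invr_ge0.
have amul m q : a (q * m)%N <= q%:R * a m.
  elim: q => [|q IH]; first by rewrite mul0n a0 mul0r.
  by rewrite mulSn (le_trans (asub _ _))// -natr1 mulrDl mul1r addrC lerD2r.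
apply/cvgrPdist_le => e e0.
have e20 : 0 < e / 2 by rewrite divr_gt0.
have [_ [m /= m0 <-] mL] := inf_adherent e20 Sinf.
have mR : 0 < m%:R :> R by rewrite ltr0n.
near=> n.
have n0 : (0 < n)%N by near: n; exists 1%N.
have nR : 0 < n%:R :> R by rewrite ltr0n.
have Ln : L <= n%:R^-1 * a n by apply: ge_inf; [exact: Sinf.2|exists n].
(* Euclidean division by a nearly optimal [m]: the remainder costs at most [m%:R * a 1], which is at
   most [n * e / 2] for large [n]. *)
have an : a n <= (n %/ m)%:R * a m + m%:R * a 1%N.
  rewrite {1}(divn_eq n m); apply: le_trans (asub _ _) _.
  apply: lerD => //; have := amul 1%N (n %% m)%N; rewrite muln1 => /le_trans; apply.
  by rewrite ler_wpM2r // ler_nat ltnW // ltn_pmod.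
have qm : (n %/ m)%:R * a m <= n%:R * (m%:R^-1 * a m).
  rewrite mulrA ler_wpM2r // ler_pdivlMr // -natrM ler_nat; exact: leq_divM.
have nbig : m%:R * a 1%N / (e / 2) <= n%:R by near: n; exact: nbhs_infty_ger.
rewrite distrC ger0_norm ?subr_ge0 // lerBlDl.
rewrite mulrC ler_pdivrMr //.
move: nbig; rewrite ler_pdivrMr // => nbig.
have : n%:R * (m%:R^-1 * a m) <= n%:R * (L + e / 2).
  by rewrite ler_wpM2l // ltW.
lra.
Unshelve. all: by end_near. Qed.

(** * Almost everywhere convergence of almost minimizers *)

Section almost_everywhere_convergence.
Context (R : realType) (d : measure_display) (X : measurableType d).
Variable mu : probability X R.

(** By monotone convergence the total variation of [u ^~ x] has a finite integral, so it is finite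
    for almost every [x]; a real sequence of finite total variation converges. *)
Lemma ae_cvg_summable_increments (u : nat -> X -> R) (M : R) :
  (forall i, measurable_fun setT (u i)) ->
  (forall n, (\sum_(i < n) \int[mu]_x `|u i.+1 x - u i x|%:E <= M%:E)%E) ->
  {ae mu, forall x, cvgn (u ^~ x)}.
Proof.
move=> mu_ uM.
pose v i x : \bar R := `|u i.+1 x - u i x|%:E.
have mv i : measurable_fun [set: X] (v i).
  apply/measurable_EFinP; apply: measurableT_comp => //.
  exact: measurable_funB.
have v0 i x : setT x -> (0 <= v i x)%E by move=> _; rewrite lee_fin.
pose F x : \bar R := (\sum_(i <oo) v i x)%E.
have mF : measurable_fun [set: X] F.
  by apply: ge0_emeasurable_sum => // k x _ _; exact: v0.
have F0 x : (0 <= F x)%E by apply: nneseries_ge0 => n _ _; exact: v0.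
have intF : mu.-integrable setT F.
  apply/integrableP; split => //.
  under eq_integral do rewrite gee0_abs //.
  rewrite integral_nneseries //.
  apply: (@le_lt_trans _ _ M%:E); last exact: ltry.
  apply: lime_le.
    by apply: is_cvg_nneseries => n _ _; apply: integral_ge0 => x; exact: v0.
  by near=> n; rewrite big_mkord; exact: uM.
apply: filterS (integrable_ae measurableT intF) => x /(_ I) Ffin.
have -> : u ^~ x = (fun n => u 0%N x + series (telescope (u ^~ x)) n).
  by apply/funext => n; exact: (eq_sum_telescope (u ^~ x)).
apply: is_cvgD; first exact: is_cvg_cst.
apply: normed_cvg; apply: nondecreasing_is_cvgn.
  by apply: nondecreasing_series => n _ _; exact: normr_ge0.
exists (fine (F x)) => _ [n _ <-].
rewrite -lee_fin fineK // /series /= -sumEFin.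
by apply: nneseries_lim_ge => i _ _; exact: v0.
Unshelve. all: by end_near. Qed.

Lemma Rintegral_probability_cst (k : R) : \int[mu]_(x in [set: X]) k = k.
Proof. by rewrite Rintegral_cst // [X in fine X]probability_setT mulr1. Qed.

Lemma integrable_exp (h : X -> R) : measurable_fun setT h -> (forall x, 0 <= h x) ->
  mu.-integrable setT (EFin \o (fun x => expR (- h x))).
Proof.
move=> mh h0; apply: (@le_integrable _ _ _ mu setT _ _ (EFin \o cst 1)) => //.
- by apply/measurable_EFinP; do 2 apply: measurableT_comp => //.
- move=> x _ /=; rewrite lee_fin normr1 ger0_norm ?expR_ge0 //.
  by rewrite -expR0 ler_expR oppr_le0.
- exact: finite_measure_integrable_cst.
Qed.

(* The functional [h |-> \int exp (- h)] is strictly convex, with defect at a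
   midpoint equal to half the squared L2 distance of the [exp (- h / 2)].
   Almost minimizers over the decreasing convex sets [P n] are therefore Cauchy. *)
Lemma midpoint_closed_selection (P : nat -> (X -> R) -> Prop) :
  (forall n h, P n h -> measurable_fun setT h) ->
  (forall n h x, P n h -> 0 <= h x) ->
  (forall n m h, (n <= m)%N -> P m h -> P n h) ->
  (forall n h k, P n h -> P n k -> P n (fun x => (h x + k x) / 2)) ->
  (forall n, exists h, P n h) ->
  exists2 h : nat -> X -> R, forall i, P i (h i) &
    {ae mu, forall x, cvgn (fun i => expR (- (h i x / 2)))}.
Proof.
move=> Pm P0 Pdec Pmid Pex.
pose J (h : X -> R) := \int[mu]_x expR (- h x).
have J0 h : 0 <= J h by apply: Rintegral_ge0 => x _; exact: expR_ge0.
have J1 n h : P n h -> J h <= 1.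
  move=> Ph; rewrite -(Rintegral_probability_cst 1).
  apply: le_Rintegral => //.
  - by apply: integrable_exp => [|x]; [exact: Pm Ph|exact: P0 Ph].
  - exact: finite_measure_integrable_cst.
  - by move=> x _; rewrite -expR0 ler_expR oppr_le0; exact: P0 Ph.
pose S n := J @` P n; pose Inf n := inf (S n).
have Slb n : has_inf (S n).
  have [h Ph] := Pex n; split; first by exists (J h), h.
  by exists 0 => _ [k _ <-].
have InfJ n h : P n h -> Inf n <= J h.
  by move=> Ph; apply: ge_inf; [exact: (Slb n).2|exists h].
have supI : has_sup (range Inf).
  split; first by exists (Inf 0%N), 0%N.
  exists 1 => _ [n _ <-]; have [h Ph] := Pex n.
  exact: le_trans (InfJ _ _ Ph) (J1 _ _ Ph).
(* The tolerance [4^-1 ^+ i] bounds squared L2 distances, so the distances themselves are of order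
   [2^-1 ^+ i] and summable. *)
pose L := sup (range Inf); pose e i : R := 4^-1 ^+ i.
have e0 i : 0 < e i by rewrite exprn_gt0 // invr_gt0.
have InfL n : Inf n <= L by apply: ub_le_sup; [exact: supI.2|exists n].
have /choice[N NL] : forall i, exists n, L - e i < Inf n.
  by move=> i; have [_ [n _ <-] ?] := sup_adherent (e0 i) supI; exists n.
(* Summing the [N j] makes [K] monotone and at least [N i]. Hence [h i] and [h i.+1] both lie in
   [P (K i)], and their midpoint lies in [P (N i)], where [J] exceeds [L - e i]. *)
pose K i := (i + \sum_(j < i.+1) N j)%N.
have iK i : (i <= K i)%N by rewrite leq_addr.
have NK i : (N i <= K i)%N by rewrite /K big_ord_recr /= addnA leq_addl.
have KS i : (K i <= K i.+1)%N.
  by rewrite /K [X in (_ <= _ + X)%N]big_ord_recr /= leq_add // leq_addr.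
have /choice[h hP] : forall i, exists h, P (K i) h /\ J h < L + e i.
  move=> i; have [_ [h Ph <-] hi] := inf_adherent (e0 i) (Slb (K i)).
  by exists h; split => //; apply: lt_le_trans hi _; rewrite lerD2r; exact: InfL.
have hm i : measurable_fun setT (h i) by exact: Pm (hP i).1.
have h0 i x : 0 <= h i x by exact: P0 (hP i).1.
exists h => [i|]; first exact: Pdec (iK i) (hP i).1.
pose u i x := expR (- (h i x / 2)).
pose mid i x := (h i x + h i.+1 x) / 2.
have mmid i : measurable_fun setT (mid i).
  apply: measurable_funM; last exact: measurable_cst.
  by apply: measurable_funD; exact: hm.
have mid0 i x : 0 <= mid i x by rewrite divr_ge0 // addr_ge0.
have Jmid i : L - e i < J (mid i).
  apply: lt_le_trans (NL i) _; apply: InfJ; apply: (Pdec _ _ _ (NK i)).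
  by apply: Pmid; [exact: (hP i).1|exact: (Pdec _ _ _ (KS i) (hP i.+1).1)].
have sq i x : (u i.+1 x - u i x) ^+ 2 =
    expR (- h i x) + expR (- h i.+1 x) - 2 * expR (- mid i x).
  have -> : expR (- h i x) = u i x * u i x.
    by rewrite /u -expRD; congr expR; field.
  have -> : expR (- h i.+1 x) = u i.+1 x * u i.+1 x.
    by rewrite /u -expRD; congr expR; field.
  have -> : expR (- mid i x) = u i x * u i.+1 x.
    by rewrite /u /mid -expRD; congr expR; field.
  ring.
have int_exp i := integrable_exp _ (hm i) (h0 i).
have int_mid i := integrable_exp _ (mmid i) (mid0 i).
(* With [t] the increment of [u] and [p = 2 ^+ i], this is the bound
   [t <= 1 / (2 * p) + p * t ^+ 2 / 2], used in place of Cauchy-Schwarz. The squared increment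
   integrates to at most [4 * e i], whence the factor [5 / 2] below and the total bound 5. *)
pose b i x : R := 2^-1 ^+ i / 2 + 2 ^+ i / 2 *
  (expR (- h i x) + expR (- h i.+1 x) - 2 * expR (- mid i x)).
have int2 i : mu.-integrable setT (EFin \o (fun x => 2 * expR (- mid i x))).
  exact: (integrableZl measurableT 2 (int_mid i)).
have intD i : mu.-integrable setT (EFin \o (fun x => expR (- h i x) + expR (- h i.+1 x))).
  exact: (integrableD measurableT (int_exp i) (int_exp i.+1)).
have intq i : mu.-integrable setT (EFin \o (fun x =>
    expR (- h i x) + expR (- h i.+1 x) - 2 * expR (- mid i x))).
  exact: (integrableB measurableT (intD i) (int2 i)).
have intc i : mu.-integrable setT (EFin \o (fun x => 2 ^+ i / 2 *
    (expR (- h i x) + expR (- h i.+1 x) - 2 * expR (- mid i x)))).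
  exact: (integrableZl measurableT (2 ^+ i / 2) (intq i)).
have intk i : mu.-integrable setT (EFin \o cst (2^-1 ^+ i / 2 : R)).
  exact: finite_measure_integrable_cst.
have intb i : mu.-integrable setT (EFin \o b i).
  exact: (integrableD measurableT (intk i) (intc i)).
have Ib i : \int[mu]_x b i x <= 5 / 2 * 2^-1 ^+ i.
  rewrite /b RintegralD //; last exact: intk.
  rewrite [X in X + _]Rintegral_probability_cst.
  rewrite RintegralZl // RintegralB // RintegralD // RintegralZl //.
  have := (hP i).2; have := (hP i.+1).2; have := Jmid i; rewrite -!/(J _).
  have eS : e i.+1 <= e i by rewrite /e exprS ler_piMl ?exprn_ge0 //; lra.
  have p0 : 0 < 2 ^+ i :> R by rewrite exprn_gt0.
  have ep : 2 ^+ i * e i = 2^-1 ^+ i.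
    by rewrite /e -exprMn; congr (_ ^+ _); field.
  move=> j1 j2 j3.
  have : 2 ^+ i * (J (h i) + J (h i.+1) - 2 * J (mid i)) <= 2 ^+ i * (4 * e i).
    by rewrite ler_wpM2l ?ltW //; lra.
  rewrite [leRHS]mulrCA ep.
  rewrite (mulrAC (2 ^+ i) 2^-1).
  move: (2 ^+ i * _) (2^-1 ^+ i) => z q; lra.
have ub i x : `|u i.+1 x - u i x| <= b i x.
  rewrite /b -sq -(real_normK (num_real (u i.+1 x - u i x))).
  have p0 : 0 < 2 ^+ i :> R by rewrite exprn_gt0.
  rewrite exprVn; set t := `|_|; set p := 2 ^+ i in p0 *.
  rewrite -subr_ge0 (_ : _ - t = (1 - p * t) ^+ 2 / (2 * p)); last by field; lra.
  by rewrite divr_ge0 ?sqr_ge0 // mulr_ge0 // ltW.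
have mu_ i : measurable_fun setT (u i).
  apply: measurableT_comp => //; apply: measurableT_comp => //.
  by apply: measurable_funM; [exact: hm|exact: measurable_cst].
apply: (@ae_cvg_summable_increments u 5) => // n.
apply: (@le_trans _ _ (\sum_(i < n) 5 / 2 * 2^-1 ^+ i)%:E).
  rewrite -sumEFin; apply: lee_sum => i _.
  apply: (@le_trans _ _ (\int[mu]_x (b i x)%:E)%E).
    apply: ge0_le_integral => //.
    - apply/measurable_EFinP; apply: measurableT_comp => //; exact: measurable_funB.
    - exact: measurable_int (intb i).
    - by move=> x _; rewrite lee_fin; exact: ub.
  rewrite -[leLHS]fineK; last exact: (integrable_fin_num measurableT (intb i)).
  by rewrite lee_fin; exact: Ib.
rewrite lee_fin -mulr_sumr.
have : \sum_(i < n) 2^-1 ^+ i = 2 - 2 * 2^-1 ^+ n :> R.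
  elim: n => [|n IH]; first by rewrite big_ord0 expr0; lra.
  rewrite big_ord_recr /= IH exprS; lra.
move=> ->; have : 0 <= 2^-1 ^+ n :> R by rewrite exprn_ge0.
lra.
Qed.

End almost_everywhere_convergence.

(** Convergence of the exponentials only gives a limit of [h i x] in the extended half-line. Fatou's
    lemma bounds the integral of the lower limit by [C], which excludes the value [+oo] almost
    everywhere and gives the integral bound on the limit. *)
Lemma ae_cvg_of_expR (R : realType) (d : measure_display) (X : measurableType d)
  (mu : probability X R) (h : nat -> X -> R) (C : R) :
  (forall i, measurable_fun setT (h i)) -> (forall i x, 0 <= h i x) ->
  (forall i, (\int[mu]_x (h i x)%:E <= C%:E)%E) ->
  {ae mu, forall x, cvgn (fun i => expR (- (h i x / 2)))} ->
  exists f : X -> R, [/\ mu.-integrable setT (EFin \o f),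
    \int[mu]_x f x <= C & {ae mu, forall x, h ^~ x @ \oo --> f x}].
Proof.
move=> hm h0 hC hcv.
pose g i x : \bar R := (h i x)%:E.
have gm i : measurable_fun [set: X] (g i) by apply/measurable_EFinP; exact: hm.
have g0 i x : [set: X] x -> (0 <= g i x)%E by rewrite lee_fin.
pose H x : \bar R := limn_einf (g ^~ x).
have mH : measurable_fun [set: X] H.
  rewrite (_ : H = (fun x => - limn_esup (fun i => - g i x))%E); last first.
    by apply/funext => x; rewrite -[RHS]limn_einfN; congr limn_einf;
      apply/funext => i; exact/esym/oppeK.
  apply: measurableT_comp => //.
  apply: (@measurable_fun_limn_esup _ _ _ _ (fun i x => - g i x)%E) => i.
  exact: measurableT_comp.
have H0 x : (0 <= H x)%E.
  rewrite /H limn_einf_lim; apply: lime_ge; first exact: is_cvg_einfs.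
  by apply: nearW => n; apply: le_ereal_inf_tmp => _ [k /= _ <-]; exact: g0.
have HC : (\int[mu]_x H x <= C%:E)%E.
  apply: (le_trans (fatou mu measurableT gm g0)).
  rewrite limn_einf_lim; apply: lime_le; first exact: is_cvg_einfs.
  by apply: nearW => n; apply: le_trans (hC n); apply: ereal_inf_lbound; exists n => /=.
have intH : mu.-integrable setT H.
  apply/integrableP; split => //; under eq_integral do rewrite gee0_abs //.
  exact: le_lt_trans HC (ltry _).
have Hfin := integrable_ae measurableT intH.
have mf : measurable_fun [set: X] (EFin \o (fine \o H)).
  by apply/measurable_EFinP; exact: measurableT_comp.
have fH : {ae mu, forall x, setT x -> H x = (EFin \o (fine \o H)) x}.
  by apply: filterS Hfin => x /(_ I) Hx _ /=; rewrite fineK.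
exists (fine \o H); split.
- apply/integrableP; split => //.
  under eq_integral do rewrite /= ger0_norm ?fine_ge0 //.
  rewrite -(@ae_eq_integral _ _ _ mu setT _ _ measurableT mH mf fH).
  exact: le_lt_trans HC (ltry _).
- rewrite /Rintegral -(@ae_eq_integral _ _ _ mu setT _ _ measurableT mH mf fH).
  by rewrite -lee_fin fineK // (integrable_fin_num measurableT intH).
apply: filterS2 Hfin hcv => x /(_ I) Hx /cvg_ex[l /= ul].
have l0 : 0 <= l.
  rewrite -(cvg_lim _ ul) //; apply: limr_ge; first by apply/cvg_ex; exists l.
  by apply: nearW => n; exact: expR_ge0.
have hlim (y : \bar R) : g ^~ x @ \oo --> y -> H x = y.
  by move=> /cvg_limn_einf_sup[].
(* A zero limit of the exponentials forces [h i x] to tend to [+oo], against the finiteness of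
   [H x]; a positive limit is inverted by the continuous logarithm. *)
move: l0; rewrite le_eqVlt => /predU1P[l0|l0].
  have : H x = +oo%E.
    apply: hlim; apply/cvgeryP/cvgryPge => A.
    have /cvgrPdist_lt/(_ (expR (- (A / 2))) (expR_gt0 _)) := ul.
    apply: filterS => n; rewrite -l0 sub0r normrN ger0_norm ?expR_ge0 //.
    rewrite ltr_expR => ?; lra.
  by move=> Hy; rewrite Hy in Hx.
have hl : h ^~ x @ \oo --> - 2 * ln l.
  have -> : h ^~ x = (fun i => - 2 * ln (expR (- (h i x / 2)))).
    by apply/funext => i; rewrite expRK; field.
  by apply: cvgMl_tmp; exact: (continuous_cvg _ (continuous_ln l0) ul).
suff HE : H x = (- 2 * ln l)%:E by rewrite /= HE.
by apply: hlim; apply: cvg_EFin => //; exact: nearW.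
Qed.

(** * Measure-preserving maps and integrals of Birkhoff sums *)

Section measure_preserving.
Context {R : realType} {d : measure_display} {X : measurableType d}.
Variable mu : probability X R.

Definition preserving (T : X -> X) : Prop :=
  measurable_fun setT T /\
  forall A : set X, measurable A -> mu (T @^-1` A) = mu A.

Lemma preserving_iter {T : X -> X} (n : nat) :
  preserving T -> preserving (iter n T).
Proof.
move=> [mT pT]; elim: n => [|n [mn pn]]; first by split => // ; exact: measurable_id.
split => [|A mA]; first exact: measurableT_comp mT mn.
rewrite -(pT A mA) -[RHS]pn //.
by rewrite -[X in measurable X]setTI; exact: mT.
Qed.

Lemma preserving_ae {T : X -> X} (P : X -> Prop) : preserving T ->
  {ae mu, forall x, P x} -> {ae mu, forall x, P (T x)}.
Proof.
move=> [mT pT] [N [mN N0 PN]]; exists (T @^-1` N); split.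
- by rewrite -[X in measurable X]setTI; exact: mT.
- by rewrite -N0; exact: pT.
- by move=> x /= nP; exact: PN.
Qed.

Lemma preserving_integral {T : X -> X} {f : X -> R} : preserving T ->
  mu.-integrable setT (EFin \o f) ->
  mu.-integrable setT (EFin \o (f \o T)) /\
  \int[mu]_x f (T x) = \int[mu]_x f x.
Proof.
move=> [mT pT] intf.
pose TT : {mfun X >-> X} := HB.pack T (isMeasurableFun.Build _ _ _ _ T mT).
have mf : measurable_fun [set: X] (EFin \o f) by exact: measurable_int intf.
have push (F : X -> \bar R) : (\int[pushforward mu TT]_x F x = \int[mu]_x F x)%E.
  by apply: eq_measure_integral => A mA _; exact: pT.
have intfT : mu.-integrable setT (EFin \o (f \o T)).
  apply/integrableP; split.
    by apply/measurable_EFinP; apply: measurableT_comp => //; exact/measurable_EFinP.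
  have := @ge0_integral_pushforward _ _ _ _ _ T mT mu setT
    (fun x => `|f x|%:E)%E measurableT.
  rewrite push preimage_setT => <-.
  - by case/integrableP : intf.
  - by apply/measurable_EFinP; apply: measurableT_comp => //; exact/measurable_EFinP.
  - by move=> x _; rewrite lee_fin.
split => //; rewrite /Rintegral; congr fine.
by rewrite -[RHS]push (integral_pushforward mT mf).
Qed.

Lemma preserving_integral_sum {T : X -> X} {f : X -> R} (n : nat) : preserving T ->
  mu.-integrable setT (EFin \o f) ->
  mu.-integrable setT (EFin \o (fun x => \sum_(k < n) f (iter k T x))) /\
  \int[mu]_x (\sum_(k < n) f (iter k T x)) = n%:R * \int[mu]_x f x.
Proof.
move=> pT intf; elim: n => [|n [IH1 IH2]].
  have -> : (fun x => \sum_(k < 0) f (iter k T x)) = cst 0.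
    by apply/funext => x; rewrite big_ord0.
  by split; [exact: integrable0|rewrite /Rintegral integral0 mul0r].
have [i1 i2] := preserving_integral (preserving_iter n pT) intf.
have -> : (fun x => \sum_(k < n.+1) f (iter k T x)) =
    (fun x => \sum_(k < n) f (iter k T x) + f (iter n T x)).
  by apply/funext => x; rewrite big_ord_recr.
split; first exact: (integrableD measurableT IH1 i1).
by rewrite RintegralD // IH2 i2 -natr1 mulrDl mul1r.
Qed.

(** The maximum with 0 changes the difference only on a null set, so linearity and invariance give
    its integral. This serves both to bound the integral of a minorant from above and to compute the
    integral of the remainder. *)
Lemma integral_birkhoff_gap {T : X -> X} {f u : X -> R} (n : nat) : preserving T ->
  mu.-integrable setT (EFin \o f) -> mu.-integrable setT (EFin \o u) ->
  {ae mu, forall x, \sum_(k < n) f (iter k T x) <= u x} ->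
  (\int[mu]_x (Num.max 0 (u x - \sum_(k < n) f (iter k T x)))%:E =
   (\int[mu]_x u x - n%:R * \int[mu]_x f x)%:E)%E.
Proof.
move=> pT intf intu fu.
have [i1 i2] := preserving_integral_sum n pT intf.
pose w x := u x - \sum_(k < n) f (iter k T x).
have iw : mu.-integrable setT (EFin \o w) by exact: (integrableB measurableT intu i1).
have mw : measurable_fun [set: X] (EFin \o w) by exact: measurable_int iw.
rewrite -i2 -RintegralB // -/w fineK; last exact: (integrable_fin_num measurableT iw).
apply: (@ae_eq_integral _ _ _ mu setT _ _ measurableT) => //.
  by apply/measurable_EFinP; apply: measurable_maxr => //; exact/measurable_EFinP.
apply: filterS fu => x fux _ /=; congr EFin.
by apply/max_idPr; rewrite subr_ge0.
Qed.

End measure_preserving.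

(** * The additive minorant of a subadditive cocycle *)

Lemma kingman_minorant {R : realType} {d : measure_display} {X : measurableType d}
  {mu : probability X R} {T : X -> X} {g : nat -> X -> R} :
  preserving mu T ->
  (forall n, mu.-integrable setT (EFin \o g n)) ->
  (forall x, g 0%N x = 0) -> (forall n x, 0 <= g n x) ->
  (forall n m x, g (n + m)%N x <= g n x + g m (iter n T x)) ->
  exists phi : X -> R, [/\ mu.-integrable setT (EFin \o phi),
    (fun n => n%:R^-1 * \int[mu]_x g n x) @ \oo --> \int[mu]_x phi x &
    {ae mu, forall x, forall n, \sum_(k < n) phi (iter k T x) <= g n x}].
Proof.
move=> pT ig g0 gge0 gsub.
pose a n := \int[mu]_x g n x.
have igT n m : mu.-integrable setT (EFin \o (g n \o iter m T)).
  exact: (preserving_integral mu (preserving_iter mu m pT) (ig n)).1.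
have aT n m : \int[mu]_x g n (iter m T x) = a n.
  exact: (preserving_integral mu (preserving_iter mu m pT) (ig n)).2.
have a0 : a 0%N = 0.
  rewrite /a (_ : g 0%N = cst 0); last by apply/funext => x; exact: g0.
  by rewrite /Rintegral integral0.
have age0 n : 0 <= a n by apply: Rintegral_ge0 => x _; exact: gge0.
have asub n m : a (n + m)%N <= a n + a m.
  rewrite -(aT m n) -RintegralD //; last exact: igT.
  apply: le_Rintegral => //.
  exact: (integrableD measurableT (ig n) (igT m n)).
have acvg := fekete a0 age0 asub.
set A := inf _ in acvg.
have Alb n : (0 < n)%N -> A <= n%:R^-1 * a n.
  move=> n0; apply: ge_inf; last by exists n.
  by exists 0 => _ [k _ <-]; rewrite mulr_ge0 ?invr_ge0.
(* The boundary error of [sum_increments_le] along the orbit of [x]. *)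
pose E m x := \sum_(j < m) g (m - j)%N (iter j T x) + \sum_(k < m) g k x.
have E0 m x : 0 <= E m x by rewrite addr_ge0 // sumr_ge0.
(* The window length is [n = i.+1], hence nonzero. The integral bound does not depend on [i], so it
   passes to the limit by Fatou and becomes the lower bound [A] for the integral of [phi]. As [i]
   grows, more [m] are constrained and the error shrinks, so the sets decrease. *)
pose D i (h : X -> R) := [/\ mu.-integrable setT (EFin \o h),
  forall x, 0 <= h x, \int[mu]_x h x <= a 1%N - A &
  forall m x, (m <= i.+1)%N ->
    \sum_(j < m) (g 1%N (iter j T x) - h (iter j T x)) <= g m x + E m x / i.+1%:R].
have [h hD hcv] : exists2 h, forall i, D i (h i) &
    {ae mu, forall x, cvgn (fun i => expR (- (h i x / 2)))}.
  apply: midpoint_closed_selection.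
  - by move=> i h [/measurable_int/measurable_EFinP].
  - by move=> i h x [_ + _ _]; exact.
  - move=> i k h ik [h1 h2 h3 h4]; split => // m x mi.
    apply: le_trans (h4 m x _) _; first exact: leq_trans mi _.
    by rewrite lerD2l ler_wpM2l // lef_pV2 ?posrE ?ltr0n // ler_nat.
  - move=> i h k [h1 h2 h3 h4] [k1 k2 k3 k4].
    have ihk : mu.-integrable setT (EFin \o (fun x => h x + k x)).
      exact: (integrableD measurableT h1 k1).
    split.
    + exact: (integrableZr measurableT 2^-1 ihk).
    + by move=> x; rewrite divr_ge0 // addr_ge0.
    + by rewrite RintegralZr // RintegralD //; lra.
    + move=> m x mi; have := h4 m x mi; have := k4 m x mi.
      rewrite !sumrB => k5 h5.
      have -> : \sum_(j < m) (h (iter j T x) + k (iter j T x)) / 2 =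
        (\sum_(j < m) h (iter j T x) + \sum_(j < m) k (iter j T x)) / 2.
        by rewrite -mulr_suml big_split.
      move: k5 h5; move: (E m x / _) (\sum_(j < m) h _) (\sum_(j < m) k _).
      by move: (\sum_(j < m) g _ _) => *; lra.
  (* Nonemptiness: the witness is [g 1] minus the average of the increments. It is nonnegative since
     each increment is at most [g 1]; the integrals of the increments telescope to [a i.+1], and [A]
     is at most [a i.+1] divided by [i.+1]. *)
  - move=> i; pose q n x := \sum_(k < n) (g k.+1 x - g k (T x)).
    have iT1 k : mu.-integrable setT (EFin \o (fun x => g k.+1 x - g k (T x))).
      exact: (integrableB measurableT (ig k.+1) (igT k 1%N)).
    have [qi qa] : mu.-integrable setT (EFin \o q i.+1) /\ \int[mu]_x q i.+1 x = a i.+1.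
      elim: i.+1 => [|n [IH1 IH2]].
        have -> : q 0%N = cst 0 by apply/funext => x; rewrite /q big_ord0.
        by split; [exact: integrable0|rewrite /Rintegral integral0 a0].
      have -> : q n.+1 = (fun x => q n x + (g n.+1 x - g n (T x))).
        by apply/funext => x; rewrite /q big_ord_recr.
      split; first exact: (integrableD measurableT IH1 (iT1 n)).
      rewrite RintegralD // IH2 RintegralB //; last exact: (igT n 1%N).
      by rewrite (aT n 1%N) addrC subrK.
    have iR : 0 < i.+1%:R :> R by rewrite ltr0n.
    have qi' : mu.-integrable setT (EFin \o (fun x => i.+1%:R^-1 * q i.+1 x)).
      exact: (integrableZl measurableT i.+1%:R^-1 qi).
    exists (fun x => g 1%N x - i.+1%:R^-1 * q i.+1 x); split.
    + exact: (integrableB measurableT (ig 1%N) qi').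
    + move=> x; rewrite subr_ge0 mulrC ler_pdivrMr // mulr_natr.
      have -> : g 1%N x *+ i.+1 = \sum_(k < i.+1) g 1%N x.
        by rewrite sumr_const card_ord.
      by apply: ler_sum => k _; rewrite lerBlDr; exact: (gsub 1%N k x).
    + rewrite RintegralB // RintegralZl // qa lerD2l lerN2; exact: Alb.
    + move=> m x mi.
      under eq_bigr do rewrite subKr.
      rewrite -mulr_sumr mulrC ler_pdivrMr // mulrDl -[X in _ + X]mulrA.
      rewrite mulVf ?gt_eqF // mulr1 mulrC.
      apply: (@sum_increments_le _ (fun k j => g k (iter j T x))) => //.
      by move=> k l j; rewrite (addnC j) iterD; exact: gsub.
have [f [fi fC fcv]] : exists f : X -> R, [/\ mu.-integrable setT (EFin \o f),
    \int[mu]_x f x <= a 1%N - A & {ae mu, forall x, h ^~ x @ \oo --> f x}].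
  apply: ae_cvg_of_expR => //.
  - by move=> i; have [/measurable_int/measurable_EFinP] := hD i.
  - by move=> i; have [] := hD i.
  - move=> i; have [h1 _ h3 _] := hD i.
    by rewrite -[leLHS]fineK ?lee_fin //; exact: (integrable_fin_num measurableT h1).
pose phi x := g 1%N x - f x.
have iphi : mu.-integrable setT (EFin \o phi).
  exact: (integrableB measurableT (ig 1%N) fi).
have phile : {ae mu, forall x, forall n, \sum_(k < n) phi (iter k T x) <= g n x}.
  (* Birkhoff sums need convergence along the whole forward orbit: a countable intersection of
     preimages of a set of full measure. *)
  have : {ae mu, forall x, forall k, h ^~ (iter k T x) @ \oo --> f (iter k T x)}.
    apply: ae_foralln => k.
    exact: (preserving_ae mu (fun x => h ^~ x @ \oo --> f x)
      (preserving_iter mu k pT) fcv).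
  apply: filterS => x cv m.
  have L1 : (fun i => \sum_(j < m) (g 1%N (iter j T x) - h i (iter j T x))) @ \oo -->
      \sum_(j < m) phi (iter j T x).
    apply: cvg_big => [|j _]; first exact: add_continuous.
    by apply: cvgB; [exact: cvg_cst|exact: cv].
  have L2 : (fun i => g m x + E m x / i.+1%:R) @ \oo --> g m x + E m x * 0.
    by apply: cvgD; [exact: cvg_cst|apply: cvgMl_tmp; exact: cvg_harmonic].
  rewrite mulr0 addr0 in L2.
  apply: (ler_cvg_to L1 L2).
  near=> i; have [_ _ _ h4] := hD i; apply: h4.
  by apply: leqW; near: i; exists m.
have phiA : \int[mu]_x phi x = A.
  (* The lower bound comes from the bound on the integral of [f]. For the upper one, integrating the
     minorization gives [n] times the integral of [phi] at most [a n] for every positive [n], and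
     [A] is the infimum of the quotients. *)
  apply/le_anti/andP; split; last first.
    by rewrite /phi RintegralB // -/(a _); lra.
  apply: lb_le_inf; first by exists (1%:R^-1 * a 1%N), 1%N.
  move=> _ [n /= n0 <-].
  have nR : 0 < n%:R :> R by rewrite ltr0n.
  rewrite mulrC ler_pdivlMr // mulrC -subr_ge0 -lee_fin.
  rewrite -(integral_birkhoff_gap mu n pT iphi (ig n)).
    by apply: integral_ge0 => x _; rewrite lee_fin le_max lexx.
  by apply: filterS phile => x; exact.
by exists phi; split => //; rewrite phiA.
Unshelve. all: by end_near. Qed.

(** * The norm cocycle and its decomposition *)

Theorem mainTheorem9 (R : realType) (d : measure_display)
  (X : measurableType d) (mu : probability X R) (T Tinv : X -> X)
  (B : completeNormedModType R)
  (c : int -> X -> B -> B) (s : X -> int -> int -> B) :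
  standard_borel (R := R) X ->
  inv_mpt mu T Tinv ->
  ergodic mu T ->
  separable_space B ->
  reflexive_space B ->
  (forall n x, lin_isometry (c n x)) ->
  (forall n m x, c (n + m) x = c n x \o c m (zact T Tinv n x)) ->
  (forall n b, borel_measurable (fun x => c n x b)) ->
  (forall x m l n, s x m l + s x l n = s x m n) ->
  (forall k x m n, c k x (s (zact T Tinv k x) m n) = s x (m + k) (n + k)) ->
  (forall m n, weakly_measurable (fun x => s x m n)) ->
  (forall n, mu.-integrable setT (fun x => (`|s x 0 n|)%:E)) ->
  exists (phi : X -> R) (r : nat -> X -> R),
    [/\ mu.-integrable setT (EFin \o phi),
        (fun n : nat => (n%:R)^-1 *
            fine (\int[mu]_x (`|s x 0 n%:Z|)%:E)) @ \oo
          --> fine (\int[mu]_x (phi x)%:E),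
        (forall n, (0 < n)%N -> measurable_fun setT (r n)) /\
        (forall n x, (0 < n)%N -> 0 <= r n x),
        {ae mu, forall x, forall n : nat, (0 < n)%N ->
           `|s x 0 n%:Z| = \sum_(k < n) phi (iter k T x) + r n x} &
        ((forall n m x, (0 < n)%N -> (0 < m)%N ->
           r (n + m)%N x <= r n x + r m (iter n T x)) /\
        (fun n : nat => (((n%:R)^-1)%:E * \int[mu]_x (r n x)%:E)%E) @ \oo
          --> 0%E)].
Proof.
move=> _ [_ _ mT _ pT] _ _ _ ciso _ _ scoc sequi _ sint.
have pr : preserving mu T by split.
pose g n x := `|s x 0 n%:Z|.
have g0 x : g 0%N x = 0.
  have /eqP := scoc x 0 0 0.
  by rewrite -[X in _ == X]addr0 (inj_eq (addrI _)) /g => /eqP ->; rewrite normr0.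
have gsub n m x : g (n + m)%N x <= g n x + g m (iter n T x).
  (* Equivariance with shift [n] moves the base point back to [x], and the cocycle acts by
     isometries; subadditivity is then the triangle inequality through the intermediate index
     [n]. *)
  have -> : g m (iter n T x) = `|s x n%:Z (n + m)%N%:Z|.
    have := sequi n%:Z x 0 m%:Z; rewrite add0r /= addrC -PoszD => <-.
    by have [_ ->] := ciso n%:Z x.
  by rewrite /g -(scoc x 0 n%:Z (n + m)%N%:Z) ler_normD.
have ig n : mu.-integrable setT (EFin \o g n) by exact: sint.
have [phi [iphi cphi phile]] :=
  kingman_minorant pr ig g0 (fun n x => normr_ge0 _) gsub.
(* Truncation at 0 makes nonnegativity hold at every point, including the null set where the
   minorization may fail. *)
pose r n x := Num.max 0 (g n x - \sum_(k < n) phi (iter k T x)).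
exists phi, r; split => //.
- split=> [n _|n x _]; last by rewrite le_max lexx.
  apply: measurable_maxr => //; apply: measurable_funB.
    by apply/measurable_EFinP; exact: measurable_int (ig n).
  apply/measurable_EFinP.
  exact: measurable_int (preserving_integral_sum mu n pr iphi).1.
- apply: filterS phile => x le_x n _; rewrite /r.
  by rewrite (max_idPr _) ?subr_ge0 // addrC subrK.
(* Subadditivity also holds at every point: Birkhoff sums are additive along the orbit, and the
   positive part of a subadditive cocycle is subadditive. *)
split=> [n m x _ _|].
  rewrite /r big_split_ord /=.
  have -> : \sum_(i < m) phi (iter (n + i) T x) =
      \sum_(i < m) phi (iter i T (iter n T x)).
    by apply: eq_bigr => i _; rewrite addnC iterD.
  move: (gsub n m x); set y := iter n T x.
  set u := \sum_(_ < n) _; set v := \sum_(_ < m) _ => gnm.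
  have ux : g n x - u <= Num.max 0 (g n x - u) by rewrite le_max lexx orbT.
  have vy : g m y - v <= Num.max 0 (g m y - v) by rewrite le_max lexx orbT.
  rewrite ge_max addr_ge0 ?le_max ?lexx //=; lra.
have rE n : (\int[mu]_x (r n x)%:E =
    (\int[mu]_x g n x - n%:R * \int[mu]_x phi x)%:E)%E.
  by apply: integral_birkhoff_gap => //; apply: filterS phile => x; exact.
under eq_fun do rewrite rE -EFinM.
apply/cvg_EFin; first exact: nearW.
rewrite -(subrr (\int[mu]_x phi x)).
apply: cvg_trans (cvgB cphi (cvg_cst _)).
(* The two sequences agree only for nonzero [n], since the inverse of 0 is 0. *)
apply: near_eq_cvg; near=> n => /=.
have n0 : n%:R != 0 :> R by rewrite pnatr_eq0 -lt0n; near: n; exists 1%N.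
by rewrite mulrBr mulKf.
Unshelve. all: by end_near. Qed.
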